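(* Let $A$ be an abelian group, let $\mathcal{T}$ be a functorial topology on $A$ (that is, $\mathcal{T}=t(A)$ for some functorial topology $t$), and let $\mathfrak{B}$ be the set of all neighborhoods of zero of $(A,\mathcal{T})$. For each $V\in\mathfrak{B}$ put $P(V)=\{\alpha\in \mathrm{End} A\mid \alpha(A)\subset V\}$. Then the family $\{P(V)\}_{V\in\mathfrak{B}}$ defines (as a fundamental system of neighborhoods of zero) a Hausdorff right bounded ring topology on $\mathrm{End} A$.
   Context: Let $\mathcal{A}$ be the class of all abelian groups. Suppose that for every $A\in\mathcal{A}$ there is given a topology $t(A)$ under which $A$ is a topological group (not necessarily Hausdorff). The family $t=\{t(A)\mid A\in\mathcal{A}\}$ is called a functorial topology if every homomorphism between groups in $\mathcal{A}$ is continuous. A ring topology $\mathcal{T}$ on a ring $R$ is called right bounded if $(R,\mathcal{T})$ has a fundamental system of neighborhoods of zero consisting of right ideals of the multiplicative semigroup of $R$, i.e. of subsets $I\subset R$ with $xr\in I$ for all $x\in I$, $r\in R$. $\mathrm{End} A$ is the ring of endomorphisms of $A$, with multiplication being composition, $(\alpha\beta)(a)=\alpha(\beta(a))$.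
   Formalization: The Hausdorff claim for End A is made only when (A, T) is Hausdorff; without such a condition it fails, e.g. for the indiscrete functorial topology and A = Z, where End Z becomes indiscrete. All other claims are kept for every functorial topology. *)

(* Defs.v *)
From HB Require Import structures.
From mathcomp Require Import all_boot all_order all_algebra.
From mathcomp Require Import boolp classical_sets functions filter.
From mathcomp Require Import topology.

Set Implicit Arguments.
Unset Strict Implicit.
Unset Printing Implicit Defensive.

Import GRing.Theory.

Local Open Scope classical_set_scope.
Local Open Scope ring_scope.

(* Topologies as first-class objects.  [topologicalType] bundles one topology
   with its carrier, whereas a functorial topology assigns a topology to each
   group, so the topology is a separate datum here and [topologized tau] is
   the carrier of [tau] seen as a [topologicalType]. *)
Record topology (T : Type) := Topology {
  is_open : set (set T) ;
  is_openT : is_open setT ;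
  is_openI : setI_closed is_open ;
  is_open_bigcup : forall (I : Type) (f : I -> set T),
    (forall i, is_open (f i)) -> is_open (\bigcup_i f i)
}.

Definition topologized (T : Type) (tau : topology T) : Type := T.

HB.instance Definition _ (T : choiceType) (tau : topology T) :=
  Choice.copy (topologized tau) T.
HB.instance Definition _ (T : choiceType) (tau : topology T) :=
  isOpenTopological.Build (topologized tau)
    (is_openT tau) (@is_openI _ tau) (@is_open_bigcup _ tau).
HB.instance Definition _ (A : zmodType) (tau : topology A) :=
  GRing.Zmodule.copy (topologized tau) A.
HB.instance Definition _ (R : pzRingType) (tau : topology R) :=
  GRing.PzRing.copy (topologized tau) R.

Definition group_topology (A : zmodType) (tau : topology A) : Prop :=
  continuous (fun x : topologized tau * topologized tau => x.1 + x.2) /\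
  continuous (fun x : topologized tau => - x).

Definition ring_topology (R : pzRingType) (tau : topology R) : Prop :=
  group_topology tau /\
  continuous (fun x : topologized tau * topologized tau => x.1 * x.2).

(* The sets [B i], for [i] in [D], form a fundamental system of neighborhoods
   of [x]: the neighborhoods of [x] are exactly the supersets of some [B i]. *)
Definition fundamental_system (T : topologicalType) (x : T)
    (I : Type) (D : set I) (B : I -> set T) : Prop :=
  nbhs x = filter_from D B.

Definition right_mul_ideal (R : pzRingType) (I : set R) : Prop :=
  forall x r, I x -> I (x * r).

Definition right_bounded (R : pzRingType) (tau : topology R) : Prop :=
  exists2 B : set (set R),
    @fundamental_system (topologized tau) 0 (set R) B id &
    forall I, B I -> right_mul_ideal I.

(* [zmodType] is MathComp's type of all abelian groups (in a fixed universe). *)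
Record functorial_topology := FunctorialTopology {
  ftop :> forall A : zmodType, topology A ;
  ftop_group : forall A : zmodType, group_topology (ftop A) ;
  ftop_continuous : forall (A B : zmodType) (f : {additive A -> B}),
    continuous (f : topologized (ftop A) -> topologized (ftop B))
}.

(* The endomorphism ring of an abelian group: pointwise addition, and
   composition as multiplication. *)
Definition End (A : zmodType) : Type := {additive A -> A}.

Section EndRing.
Variable A : zmodType.

HB.instance Definition _ := gen_eqMixin (End A).
HB.instance Definition _ := gen_choiceMixin (End A).

Implicit Types f g h : End A.

Definition End_zero : End A := (\0 : A -> A).
Definition End_opp f : End A := (\- f : A -> A).
Definition End_add f g : End A := (f \+ g : A -> A).
Definition End_one : End A := (idfun : A -> A).
Definition End_mul f g : End A := (f \o g : A -> A).

Lemma End_ext f g : f =1 g -> f = g.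
Proof.
case: f g => [f [[Hf]]] [g [[Hg]]] /= /funext fg; case: _ / fg in Hg *.
by rewrite (Prop_irrelevance Hf Hg).
Qed.

Fact End_addA : associative End_add.
Proof. by move=> f g h; apply: End_ext => a /=; rewrite addrA. Qed.
Fact End_addC : commutative End_add.
Proof. by move=> f g; apply: End_ext => a /=; rewrite addrC. Qed.
Fact End_add0 : left_id End_zero End_add.
Proof. by move=> f; apply: End_ext => a /=; rewrite add0r. Qed.
Fact End_addN : left_inverse End_zero End_opp End_add.
Proof. by move=> f; apply: End_ext => a /=; rewrite addNr. Qed.
Fact End_mulA : associative End_mul.
Proof. by move=> f g h; apply: End_ext. Qed.
Fact End_mul1l : left_id End_one End_mul.
Proof. by move=> f; apply: End_ext. Qed.
Fact End_mul1r : right_id End_one End_mul.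
Proof. by move=> f; apply: End_ext. Qed.
Fact End_mulDl : left_distributive End_mul End_add.
Proof. by move=> f g h; apply: End_ext. Qed.
Fact End_mulDr : right_distributive End_mul End_add.
Proof. by move=> f g h; apply: End_ext => a /=; rewrite raddfD. Qed.

HB.instance Definition _ := GRing.isPzRing.Build (End A)
  End_addA End_addC End_add0 End_addN
  End_mulA End_mul1l End_mul1r End_mulDl End_mulDr.

End EndRing.

Definition maps_into (A : zmodType) (V : set A) : set (End A) :=
  [set f : End A | range f `<=` V].

(* Main.v *)
Require Import Defs.
From HB Require Import structures.
From mathcomp Require Import all_boot all_order all_algebra.
From mathcomp Require Import boolp classical_sets functions filter.
From mathcomp Require Import topology.

Import GRing.Theory.

Local Open Scope classical_set_scope.
Local Open Scope ring_scope.

(** A topology that makes an additive group a topological group is determined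
by its neighborhoods of zero; conversely a filter [F] whose members contain
zero and satisfy [V - V] included in [U] for small [V] is the neighborhood
filter of zero of such a topology, and on a ring the topology is a ring
topology as soon as small sets have small products and left and right
multiplications by a fixed element preserve smallness
([translation_ring_topology]).  So uniqueness holds, and existence amounts to
checking these conditions on the filter generated by the sets [P(V)] of
endomorphisms with range in [V].

The additive conditions are inherited pointwise from the group topology of
[A].  For the multiplicative ones, the range of [f * g] lies in that of [f],
so every [P(V)] is a right ideal; this settles products of small elements and
right multiplications, and is also right boundedness.  Left multiplication by
[g] is where functoriality enters: [g] is continuous, so [g @^-1` V] is a
neighborhood of zero, and [g * f] lies in [P(V)] when [f] lies in
[P(g @^-1` V)].

Finally, a neighborhood [f + P(V)] is carried into [f a + V] by evaluation at
any [a].  Evaluations are therefore continuous; they separate endomorphisms,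
so [End A] is Hausdorff when [A] is. *)

(** * Group topologies and their neighborhoods of zero *)

Lemma topology_ext {T : Type} (tau tau' : topology T) :
  is_open tau = is_open tau' -> tau = tau'.
Proof.
case: tau tau' => [o oT oI oU] [o' oT' oI' oU'] /= oE.
by case: _ / oE in oT' oI' oU' *; congr Topology; apply: Prop_irrelevance.
Qed.

(** Translations are homeomorphisms: the shift by [x] and the one by [- x] are
both continuous. *)
Lemma group_topology_nbhs {G : zmodType} {tau : topology G} :
  group_topology tau -> forall (x : G) (U : set G),
  nbhs (x : topologized tau) U <->
  nbhs (0 : topologized tau) [set y | U (x + y)].
Proof.
case=> addC _ x U.
have shift (z a b : topologized tau) (W : set G) : z + a = b ->
    nbhs b W -> nbhs a [set y | W (z + y)].
  move=> zab; rewrite -zab => /(addC (z, a)) [[V1 V2] /= [zV1 aV2] VW].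
  apply: filterS aV2 => y V2y; apply: (VW (z, y)).
  by split => //=; exact: nbhs_singleton zV1.
split; first by apply: shift; rewrite addr0.
move=> /(shift (- x : G) x 0 _ (addNr _)); apply: filterS => y /=.
by rewrite addrA subrr add0r.
Qed.

(** Open sets are the neighborhoods of all their points, and these
neighborhoods are translates of those of zero. *)
Lemma group_topology_eq {G : zmodType} (tau tau' : topology G) :
  group_topology tau -> group_topology tau' ->
  nbhs (0 : topologized tau) = nbhs (0 : topologized tau') -> tau = tau'.
Proof.
move=> gtau gtau' nbhs0E; apply: topology_ext.
suff openP (s : topology G) : group_topology s ->
    is_open s = [set U | forall x, U x ->
                   nbhs (0 : topologized s) [set y | U (x + y)]].
  by rewrite !openP// nbhs0E.
move=> gs; rewrite -[LHS]/(@open (topologized s)) openE.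
apply/seteqP; split=> U Uo x Ux.
  exact: (group_topology_nbhs gs x U).1 (Uo x Ux).
exact: (group_topology_nbhs gs x U).2 (Uo x Ux).
Qed.

Lemma group_topology_subr {G : zmodType} {tau : topology G} :
  group_topology tau ->
  forall U : set G, nbhs (0 : topologized tau) U ->
  exists2 V : set G, nbhs (0 : topologized tau) V &
    forall x y, V x -> V y -> U (x - y).
Proof.
case=> addC oppC U nU.
have /(addC (0, 0)) [[V1 V2] /= [nV1 nV2] VU] :
  nbhs ((0 : topologized tau) + 0) U by rewrite addr0.
have /(oppC 0) nV2N : nbhs (- (0 : topologized tau)) V2 by rewrite oppr0.
exists (V1 `&` [set y : G | V2 (- y)]); first exact: filterI.
by move=> x y [V1x _] [_ V2y]; exact: (VU (x, - y)).
Qed.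

(** * The topology with a prescribed filter of neighborhoods of zero *)

Section TranslationTopology.
Variables (G : zmodType) (F : set_system G).
Hypothesis FF : Filter F.

Definition translation_open : set (set G) :=
  [set U | forall x, U x -> F [set y | U (x + y)]].

Fact translation_openT : translation_open setT.
Proof. by move=> x _; exact: filterT. Qed.

Fact translation_openI : setI_closed translation_open.
Proof. by move=> U V Uo Vo x [Ux Vx]; exact: filterI (Uo _ Ux) (Vo _ Vx). Qed.

Fact translation_open_bigcup (I : Type) (f : I -> set G) :
  (forall i, translation_open (f i)) -> translation_open (\bigcup_i f i).
Proof.
by move=> fo x [i _ fix_]; apply: filterS (fo i _ fix_) => y fy; exists i.
Qed.

Definition translation_topology : topology G :=
  Topology translation_openT translation_openI translation_open_bigcup.

Hypothesis F0 : forall U, F U -> U 0.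
Hypothesis FB : forall U, F U ->
  exists2 V, F V & forall x y, V x -> V y -> U (x - y).

(** The hypothesis on differences gives sums, because [y = 0 - (0 - y)]. *)
Lemma halving U : F U -> exists2 V, F V & forall x y, V x -> V y -> U (x + y).
Proof.
move=> /FB [V FV VU]; have [W FW WV] := FB _ FV.
exists (W `&` V); first exact: filterI.
move=> x y [_ Vx] [Wy _]; rewrite -[y]opprK; apply: VU => //.
by rewrite -sub0r; apply: WV => //; exact: F0.
Qed.

(** The points whose translate of [F] contains [U] form an open subset of [U];
[halving] is what makes this set open. *)
Lemma translation_nbhs (x : G) (U : set G) :
  nbhs (x : topologized translation_topology) U <-> F [set y | U (x + y)].
Proof.
rewrite nbhsE; split=> [[V [Vo Vx] VU]|FU].
  by apply: filterS (Vo x Vx) => y; exact: VU.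
have Uo : translation_open [set z | F [set y | U (z + y)]].
  move=> z /= /halving[W FW WU].
  apply: filterS (FW) => w Ww; apply: filterS FW => y Wy /=.
  by rewrite -addrA; exact: WU.
exists [set z | F [set y | U (z + y)]]; first exact: conj Uo FU.
by move=> z /F0 /=; rewrite addr0.
Qed.

Lemma translation_group_topology : group_topology translation_topology.
Proof.
split.
  have split_sum (x y u v : G) : (x + y) + ((u - x) + (v - y)) = u + v.
    by rewrite addrC addrACA !subrK.
  move=> [x y] U /translation_nbhs/halving[V FV VU].
  exists ([set z : G | V (z - x)], [set z : G | V (z - y)]) => /=.
    by split; apply/translation_nbhs; apply: filterS FV => z /=;
      rewrite addrC addKr.
  move=> [u v] [/= Vu Vv].
  by have /= := VU _ _ Vu Vv; rewrite split_sum.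
move=> x U /translation_nbhs/FB[V FV VU]; apply/translation_nbhs.
have split_opp (y : G) : - (x + y) = - x + (0 - y) :> G.
  by rewrite opprD sub0r.
apply: filterS (FV) => y Vy /=; rewrite split_opp.
exact: VU (F0 _ FV) Vy.
Qed.

End TranslationTopology.

(** Continuity of the product at [(x, y)] comes from
[u * v - x * y = (u - x) * y + x * (v - y) + (u - x) * (v - y)], whose three
terms are made small by the last three hypotheses. *)
Lemma translation_ring_topology (R : pzRingType) (F : set_system R)
    (FF : Filter F) :
  (forall U, F U -> U 0) ->
  (forall U, F U -> exists2 V, F V & forall x y, V x -> V y -> U (x - y)) ->
  (forall U, F U -> exists2 V, F V & forall x y, V x -> V y -> U (x * y)) ->
  (forall a U, F U -> F [set y | U (a * y)]) ->
  (forall a U, F U -> F [set y | U (y * a)]) ->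
  ring_topology (translation_topology R F FF).
Proof.
move=> F0 FB FM Fl Fr; split; first exact: translation_group_topology.
have nbhsP := translation_nbhs _ _ FF F0 FB.
have split_prod (x y u v : R) :
    x * y + ((u - x) * y + (x * (v - y) + (u - x) * (v - y))) = u * v.
  by rewrite addrA -!mulrDl -mulrDr ![_ + (_ - _)]addrC !subrK.
move=> [x y] U /nbhsP /(halving _ _ FF F0 FB)[V FV VU].
have [W FW WV] := halving _ _ FF F0 FB _ FV.
have [Z FZ ZW] := FM _ FW.
exists ([set z : R | (Z `&` [set u | V (u * y)]) (z - x)],
        [set z : R | (Z `&` [set u | W (x * u)]) (z - y)]) => /=.
  split; apply/nbhsP.
    by apply: filterS (filterI FZ (Fr y V FV)) => z /=; rewrite addrC addKr.
  by apply: filterS (filterI FZ (Fl x W FW)) => z /=; rewrite addrC addKr.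
move=> [u v] [/= [Zu Vu] [Zv Wv]].
by have /= := VU _ _ Vu (WV _ _ Wv (ZW _ _ Zu Zv)); rewrite split_prod.
Qed.

(** * The topology of the endomorphism ring *)

Section EndTopology.
Variables (t : functorial_topology) (A : zmodType).

Let nbhs0 : set_system A := nbhs (0 : topologized (t A)).

Definition P_filter : set_system (End A) :=
  filter_from nbhs0 (@maps_into A).

Lemma P_filter_isFilter : Filter P_filter.
Proof.
apply: filter_from_filter; first by exists setT; exact: filterT.
move=> U V nU nV; exists (U `&` V); first exact: filterI.
by move=> f; rewrite /maps_into /= subsetI.
Qed.

#[local] Existing Instance P_filter_isFilter.

Lemma P_filter0 U : P_filter U -> U 0.
Proof.
case=> V nV; apply => _ [a _ <-]; exact: nbhs_singleton nV.
Qed.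

Lemma P_filterB U : P_filter U ->
  exists2 V, P_filter V & forall x y, V x -> V y -> U (x - y).
Proof.
case=> V nV VU; have [W nW WV] := group_topology_subr (ftop_group t A) V nV.
exists (@maps_into A W); first by exists W.
move=> f g fW gW; apply: VU => _ [a _ <-].
by apply: WV; [exact: fW (imageT f a) | exact: gW (imageT g a)].
Qed.

(** [f * g] is [f] after [g], so its range is contained in that of [f]. *)
Lemma maps_into_right_mul_ideal (V : set A) : right_mul_ideal (@maps_into A V).
Proof. by move=> f g fV _ [a _ <-]; apply: fV; exists (g a). Qed.

Lemma P_filterMr (g : End A) U : P_filter U -> P_filter [set f | U (f * g)].
Proof.
case=> V nV VU; exists V => // f fV.
exact: VU (maps_into_right_mul_ideal V f g fV).
Qed.

(** The endomorphism [g] is continuous because the topology is functorial, so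
[g @^-1` V] is a neighborhood of zero. *)
Lemma P_filterMl (g : End A) U : P_filter U -> P_filter [set f | U (g * f)].
Proof.
case=> V nV VU; exists (g @^-1` V).
  by apply: (@ftop_continuous t A A g 0); rewrite raddf0.
by move=> f fV; apply: VU => _ [a _ <-]; apply: fV; exists a.
Qed.

Lemma P_filterM U : P_filter U ->
  exists2 V, P_filter V & forall x y, V x -> V y -> U (x * y).
Proof.
case=> V nV VU; exists (@maps_into A V); first by exists V.
by move=> f g fV _; exact: VU (maps_into_right_mul_ideal V f g fV).
Qed.

Definition End_topology : topology (End A) :=
  translation_topology _ _ P_filter_isFilter.

Lemma End_topology_ring : ring_topology End_topology.
Proof.
apply: translation_ring_topology.
- exact: P_filter0.
- exact: P_filterB.
- exact: P_filterM.
- exact: P_filterMl.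
- exact: P_filterMr.
Qed.

Lemma End_topology_nbhs (f : End A) (U : set (End A)) :
  nbhs (f : topologized End_topology) U <-> P_filter [set g | U (f + g)].
Proof. exact: translation_nbhs _ _ _ P_filter0 P_filterB _ _. Qed.

Lemma End_topology_nbhs0 : nbhs (0 : topologized End_topology) = P_filter.
Proof.
apply/seteqP; split=> U.
  by move=> /End_topology_nbhs; apply: filterS => g /=; rewrite add0r.
move=> FU; apply/End_topology_nbhs.
by have -> : [set g | U (0 + g)] = U by apply/funext => g /=; rewrite add0r.
Qed.

Lemma End_topology_right_bounded : right_bounded End_topology.
Proof.
exists [set maps_into V | V in nbhs0]; last first.
  by move=> _ [V _ <-]; exact: maps_into_right_mul_ideal.
rewrite /fundamental_system End_topology_nbhs0.
apply/seteqP; split=> U.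
  by case=> V nV VU; exists (maps_into V) => //; exists V.
by case=> _ [V nV <-] VU; exists V.
Qed.

(** An endomorphism in [P(V)] moves the value at [a] by an element of [V]. *)
Lemma eval_continuous (a : A) :
  continuous (fun f : topologized End_topology =>
                (f : End A) a : topologized (t A)).
Proof.
move=> f U /(group_topology_nbhs (ftop_group t A)) nU.
apply/End_topology_nbhs; exists [set y | U ((f : End A) a + y)] => // g gV.
by apply: gV; exists a.
Qed.

(** Two endomorphisms that cannot be separated have, at every [a], values that
cannot be separated, by continuity of evaluation. *)
Lemma End_topology_hausdorff :
  hausdorff_space (topologized (t A)) ->
  hausdorff_space (topologized End_topology).
Proof.
move=> hA f g fg; apply: (@End_ext A) => a; apply: hA => U V nU nV.
have [h [Uh Vh]] := fg _ _ (eval_continuous a _ _ nU) (eval_continuous a _ _ nV).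
by exists ((h : End A) a).
Qed.

End EndTopology.

Theorem theorem6 (t : functorial_topology) (A : zmodType) :
  let defined_by_P (tau : topology (End A)) :=
    ring_topology tau /\
    fundamental_system (0 : topologized tau)
      (nbhs (0 : topologized (t A))) (@maps_into A) in
  exists tau : topology (End A),
    [/\ unique defined_by_P tau,
        right_bounded tau &
        hausdorff_space (topologized (t A)) ->
        hausdorff_space (topologized tau)].
Proof.
move=> defined_by_P; exists (End_topology t A); split.
- have nbhs0E := End_topology_nbhs0 t A.
  have ringE := End_topology_ring t A.
  split=> // tau [[gtau _] nbhs0tau].
  apply: group_topology_eq => //; first by case: ringE.
  by rewrite nbhs0E nbhs0tau.
- exact: End_topology_right_bounded.
- exact: End_topology_hausdorff.
Qed.
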